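(* Let $H=(V,E)$ be a hypergraph with maximum $2$-degree $\Delta_2$. Then a single round of computation in the PRIMAL CONGEST (PC) model can be simulated in a single round of the EDGE CLIQUE (EC) model, and a single round of computation in the EC model can be simulated in $\Delta_2$ rounds of the PC model. Thus, if a task has computational complexity $T_{PC}$ in the PC model and $T_{EC}$ in the EC model, then $$T_{EC}\le T_{PC}\le \Delta_2\,T_{EC}.$$
   Context: A hypergraph $H=(V,E)$ has a finite vertex set $V$, $|V|=n$, and a set $E$ of nonempty subsets of $V$. For $u,v\in V$, $\deg(u,v)=|\{e\in E: u,v\in e\}|$, and the maximum $2$-degree (pair degree) is $\Delta_2=\max_{u\neq v}\deg(u,v)$. Each vertex is a computing node with a unique $O(\log n)$-bit ID. Computation is in synchronous rounds with unbounded local computation; messages have $B=\Theta(\log n)$ bits. Initially (knowledge $\mathrm{KT}_1$) each vertex knows its ID, degree, the IDs of all vertices in each incident edge, and a port numbering of its incident edges. The complexity of a task is the number of rounds needed. PC: in each round each vertex $v$ can send distinct $B$-bit messages to each adjacent vertex (each vertex sharing an edge with $v$), one message per adjacent vertex. EC: in each round, for each vertex $v$ and each incident edge $e\ni v$, $v$ can send distinct $B$-bit messages to each other vertex $w\in e$. *)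

(* Defs.v *)
From HB Require Import structures.
From mathcomp Require Import all_boot.

Set Implicit Arguments.
Unset Strict Implicit.
Unset Printing Implicit Defensive.

(* [trunc_log 2 n] is floor (log2 n); for n >= 2 it agrees with log n up to
   constant factors, so these are the usual O(log n) and Theta(log n). *)
Definition bigO_log (f : nat -> nat) : Prop :=
  exists c n0 : nat, forall n, n0 <= n -> f n <= c * trunc_log 2 n.

Definition bigTheta_log (f : nat -> nat) : Prop :=
  bigO_log f /\
  exists c n0 : nat, forall n, n0 <= n -> trunc_log 2 n <= c * f n.

Record hypergraph := Hypergraph {
  vertex :> finType;
  edges : {set {set vertex}};
  edges_nonempty : set0 \notin edges
}.

Definition pair_degree (H : hypergraph) (u v : H) : nat :=
  #|[set e in edges H | (u \in e) && (v \in e)]|.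

(* The maximum over an empty family of pairs (at most one vertex) is 0. *)
Definition max_pair_degree (H : hypergraph) : nat :=
  \max_(p : H * H | p.1 != p.2) pair_degree p.1 p.2.

Definition adjacent (H : hypergraph) (u v : H) : bool :=
  (u != v) && [exists e in edges H, (u \in e) && (v \in e)].

(* [port v] lists the edges incident to [v]; the port number of an edge at [v]
   is its position in that list, and port numbers at different vertices are
   unrelated. *)
Record network (n L : nat) := Network {
  net_graph :> hypergraph;
  net_card : #|net_graph| = n;
  net_id : net_graph -> L.-tuple bool;
  net_id_inj : injective net_id;
  port : net_graph -> seq {set net_graph};
  port_uniq : forall v, uniq (port v);
  port_incident :
    forall v e, (e \in port v) = (e \in edges net_graph) && (v \in e)
}.

(* KT_1 knowledge: the vertex's own ID and, for each port, the set of the IDs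
   of all the vertices of that edge (the degree is [size port_ids]). *)
Record knowledge (L : nat) := Knowledge {
  own_id : L.-tuple bool;
  port_ids : seq {set L.-tuple bool}
}.

Definition initial_knowledge n L (N : network n L) (v : N) : knowledge L :=
  Knowledge (net_id v) [seq [set net_id u | u in e] | e : {set N} <- port v].

(* A communication model fixes the local addresses under which a vertex sends
   and receives messages, and how the outboxes of all the vertices determine
   their inboxes.  [None] stands for the absence of a message. *)
Definition mailbox (A : Type) (B : nat) : Type := A -> option (B.-tuple bool).

Record model (n L B : nat) := Model {
  address : Type;
  deliver : forall N : network n L,
    (N -> mailbox address B) -> (N -> mailbox address B)
}.

(* PRIMAL CONGEST: a message is addressed to (or comes from) the adjacent
   vertex with a given ID. *)
Definition PC (n L B : nat) : model n L B :=
  @Model n L B (L.-tuple bool)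
    (fun N (outbox : N -> mailbox (L.-tuple bool) B) v a =>
       obind (fun u : N => outbox u (net_id v))
         [pick u : N | adjacent u v && (net_id u == a)]).

(* EDGE CLIQUE: a message is addressed to (or comes from) the other vertex
   with a given ID in the incident edge with a given local port number. *)
Definition EC (n L B : nat) : model n L B :=
  @Model n L B (nat * L.-tuple bool)%type
    (fun N (outbox : N -> mailbox (nat * L.-tuple bool)%type B) v ia =>
       let e := nth set0 (port v) ia.1 in
       obind (fun u : N => outbox u (index e (port u), net_id v))
         [pick u in e | (u != v) && (net_id u == ia.2)]).

(* The code of one synchronous round, common to all the vertices: it sees only
   the vertex's own initial knowledge, current state and received messages.
   Local computation is an arbitrary function. *)
Record protocol n L B (M : model n L B) (S : Type) := Protocol {
  send : knowledge L -> S -> mailbox (address M) B;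
  receive : knowledge L -> S -> mailbox (address M) B -> S
}.

Definition step n L B (M : model n L B) S (P : protocol M S)
    (N : network n L) (s : N -> S) : N -> S :=
  fun v => receive P (initial_knowledge v) (s v)
    (deliver (fun u => send P (initial_knowledge u) (s u)) v).

Definition run n L B (M : model n L B) S (P : protocol M S)
    (N : network n L) (k : nat) (s : N -> S) : N -> S :=
  iter k (step P (N := N)) s.

(* Every round of [M1] on a network [N] can be simulated in [rounds N] rounds
   of [M2]: [load] and [unload] are local computations translating between the
   states of the simulated and of the simulating protocol, and the result is
   the same at each vertex, from every configuration of local states. *)
Definition round_simulated n L B (M1 M2 : model n L B)
    (rounds : network n L -> nat) : Prop :=
  forall (S : Type) (P : protocol M1 S),
  exists (S' : Type) (Q : protocol M2 S')
         (load : knowledge L -> S -> S') (unload : knowledge L -> S' -> S),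
  forall (N : network n L) (s : N -> S) (v : N),
    unload (initial_knowledge v)
      (run Q (rounds N) (fun u => load (initial_knowledge u) (s u)) v)
    = step P s v.

Record algorithm n L B (M : model n L B) (I O : Type) := Algorithm {
  state : Type;
  init : knowledge L -> I -> state;
  code : protocol M state;
  result : knowledge L -> state -> O
}.

Arguments init {n L B M I O} a _ _.
Arguments result {n L B M I O} a _ _.

Definition execute n L B (M : model n L B) I O (A : algorithm M I O)
    (k : nat) (N : network n L) (x : N -> I) : N -> O :=
  fun v => result A (initial_knowledge v)
    (run (code A) k (fun u => init A (initial_knowledge u) (x u)) v).

(* A task: local inputs and outputs, the admissible instances (any class of
   networks and inputs), and the output assignments that solve an instance. *)
Record task (n L : nat) := Task {
  input : Type;
  output : Type;
  admissible : forall N : network n L, (N -> input) -> Prop;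
  solution : forall N : network n L, (N -> input) -> (N -> output) -> Prop
}.

(* A single algorithm has to solve all the admissible instances of maximum
   2-degree [D]; it may depend on n and [D], but learns about the network only
   through [initial_knowledge], the inputs and the messages. *)
Definition solvable_in n L B (M : model n L B) (t : task n L) (D T : nat) :
    Prop :=
  exists A : algorithm M (input t) (output t),
  forall (N : network n L) (x : N -> input t),
    max_pair_degree N = D -> admissible x ->
    solution x (execute A T x).

Definition has_complexity n L B (M : model n L B) (t : task n L) (D T : nat) :
    Prop :=
  solvable_in M t D T /\ forall T', solvable_in M t D T' -> T <= T'.

(* Main.v *)
(** A PC message from [u] to [v] travels in EC through any edge containing both
    vertices, and [v] reads it from the first port whose edge contains the ID of
    [u].  Conversely, two distinct vertices share at most Delta_2 edges, and
    since they both know the sets of IDs of these edges, they agree on an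
    ordering of them without communication; round [j] of the PC simulation
    carries the messages that EC sends through the [j]-th shared edge. *)
Require Import Defs.
From mathcomp Require Import all_boot.
From Stdlib Require Import FunctionalExtensionality.

Set Implicit Arguments.
Unset Strict Implicit.
Unset Printing Implicit Defensive.

(** * Vertex IDs and delivered messages *)

Section NetworkIds.

Variables (n L : nat) (N : network n L).
Implicit Types (u v : N) (e : {set N}).

Definition ids e : {set L.-tuple bool} := [set net_id u | u in e].

Lemma ids_inj : injective ids.
Proof. exact: imset_inj (@net_id_inj n L N). Qed.

Lemma mem_ids u e : (net_id u \in ids e) = (u \in e).
Proof. exact: mem_imset (@net_id_inj n L N). Qed.

Lemma nth_port_ids v i :
  nth set0 (port_ids (initial_knowledge v)) i = ids (nth set0 (port v) i).
Proof.
have [lt_i|ge_i] := ltnP i (size (port v)); first exact: nth_map.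
by rewrite !nth_default ?size_map // /ids imset0.
Qed.

Lemma index_port_ids v e :
  index (ids e) (port_ids (initial_knowledge v)) = index e (port v).
Proof. exact: index_map ids_inj _ _. Qed.

(** IDs are injective, so [u] is the only vertex that can be picked. *)
Lemma pick_id (P : pred N) u :
  [pick w : N | P w && (net_id w == net_id u)] = if P u then Some u else None.
Proof.
case: pickP => [w /andP[Pw /eqP/(@net_id_inj n L N) <-]|noP]; first by rewrite Pw.
by have := noP u; rewrite eqxx andbT => ->.
Qed.

Lemma adjacentP u v :
  reflect (u != v /\ exists2 e, e \in port v & u \in e) (adjacent u v).
Proof.
apply: (iffP andP) => -[uv ex_e]; split=> //.
  have /existsP[e /and3P[eE ue ve]] := ex_e.
  by exists e => //; rewrite port_incident eE.
have [e] := ex_e; rewrite port_incident => /andP[eE ve] ue.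
by apply/existsP; exists e; rewrite eE ue.
Qed.

End NetworkIds.

Lemma deliver_PC n L B (N : network n L)
    (out : N -> mailbox (L.-tuple bool) B) (v u : N) :
  deliver (m := PC n L B) out v (net_id u)
    = if adjacent u v then out u (net_id v) else None.
Proof. by rewrite /= (pick_id (fun w => adjacent w v)); case: ifP. Qed.

Lemma deliver_PC_None n L B (N : network n L)
    (out : N -> mailbox (L.-tuple bool) B) (v : N) a :
  (forall u : N, net_id u != a) -> deliver (m := PC n L B) out v a = None.
Proof. by move=> no_a /=; case: pickP => // u; rewrite (negPf (no_a u)) andbF. Qed.

Lemma deliver_EC n L B (N : network n L)
    (out : N -> mailbox (nat * L.-tuple bool) B) (v u : N) i :
  let e := nth set0 (port v) i in
  deliver (m := EC n L B) out v (i, net_id u)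
    = if (u \in e) && (u != v) then out u (index e (port u), net_id v) else None.
Proof.
move=> e /=; rewrite -/e.
under eq_pick => w do rewrite andbA.
by rewrite (pick_id (fun w => (w \in e) && (w != v))); case: ifP.
Qed.

Lemma deliver_EC_None n L B (N : network n L)
    (out : N -> mailbox (nat * L.-tuple bool) B) (v : N) i a :
  (forall u : N, net_id u != a) -> deliver (m := EC n L B) out v (i, a) = None.
Proof.
by move=> no_a /=; case: pickP => // u; rewrite (negPf (no_a u)) !andbF.
Qed.

(** Addresses are arbitrary bit strings, so inboxes must also be compared at those that are the ID
    of no vertex. *)
Lemma id_cases n L (N : network n L) (a : L.-tuple bool) :
  (exists u : N, a = net_id u) \/ (forall u : N, net_id u != a).
Proof.
case: (pickP (fun u : N => net_id u == a)) => [u /eqP <-|no_a].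
  by left; exists u.
by right=> u; rewrite no_a.
Qed.

(** * Simulation of a PC round in one EC round *)

Section PCinEC.

Variables (n L B : nat) (S : Type) (P : protocol (PC n L B) S).

(** The message goes out on every port: port numberings are unrelated, so the sender cannot tell
    which shared edge the receiver will read. *)
Definition PCinEC : protocol (EC n L B) S :=
  Protocol (M := EC n L B)
    (fun K s ia => send P K s ia.2)
    (fun K s inbox => receive P K s
       (fun a => inbox (find (fun X : {set _} => a \in X) (port_ids K), a))).

Lemma step_PCinEC (N : network n L) (s : N -> S) v :
  step PCinEC s v = step P s v.
Proof.
rewrite [LHS]/step [RHS]/step /PCinEC; cbn [send receive].
congr (receive _ _ _ _); apply: functional_extensionality => a.
have [[u ->]|no_a] := id_cases N a; last first.
  by rewrite deliver_EC_None // deliver_PC_None.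
rewrite deliver_EC deliver_PC /=.
set i := find _ _; congr (if _ then _ else _).
(* If no edge at [v] contains [u], then [find] returns the number of ports, and the default edge
   [set0] contains no vertex. *)
have mem_find : (u \in nth set0 (port v) i) = has (fun e : {set N} => u \in e) (port v).
  have -> : i = find (fun e : {set N} => u \in e) (port v).
    by rewrite /i find_map; apply: eq_find => e; exact: mem_ids.
  have [/(nth_find set0)->//|] := boolP (has _ _).
  by move/hasNfind->; rewrite nth_default // inE.
rewrite mem_find andbC; apply/andP/adjacentP => -[uv].
  by move=> /hasP[e ev ue]; split=> //; exists e.
by move=> [e ev ue]; split=> //; apply/hasP; exists e.
Qed.

End PCinEC.

(** * Edges shared by two vertices *)

Definition shared_edges L (K : knowledge L) (a : L.-tuple bool) :
    seq {set L.-tuple bool} :=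
  enum [set X in port_ids K | a \in X].

Section SharedEdges.

Variables (n L : nat) (N : network n L).
Implicit Types u v : N.

Lemma shared_edgesE u v :
  shared_edges (initial_knowledge u) (net_id v)
    = enum [set ids e | e in [set e in edges N | (u \in e) && (v \in e)]].
Proof.
apply: eq_enum => X; rewrite [LHS]inE.
apply/andP/imsetP => [[/mapP[e eu ->]]|[e]].
  rewrite (mem_ids v e) => ve.
  by exists e => //; rewrite inE ve andbT -port_incident.
rewrite inE => /and3P[eE ue ve] ->; rewrite mem_ids; split=> //.
by apply: map_f; rewrite port_incident eE.
Qed.

(** [enum] orders a set independently of the ports, so both endpoints, knowing the same set of
    shared edges, get the same list. *)
Lemma shared_edgesC u v :
  shared_edges (initial_knowledge u) (net_id v)
    = shared_edges (initial_knowledge v) (net_id u).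
Proof.
rewrite !shared_edgesE.
suff -> : [set e in edges N | (u \in e) && (v \in e)]
    = [set e in edges N | (v \in e) && (u \in e)] by [].
by apply/setP => e; rewrite !inE [(u \in e) && _]andbC.
Qed.

Lemma size_shared_edges u v :
  u != v ->
  size (shared_edges (initial_knowledge u) (net_id v)) <= max_pair_degree N.
Proof.
move=> uv; rewrite shared_edgesE -cardE card_imset; last exact: ids_inj.
exact: (@leq_bigmax_cond _ (fun p : N * N => p.1 != p.2)
  (fun p => pair_degree p.1 p.2) (u, v)).
Qed.

End SharedEdges.

(** * Simulation of an EC round in PC *)

Section ECinPC.

Variables (n L B : nat) (S : Type) (P : protocol (EC n L B) S).

(** For [j] past the last shared edge the message is junk, which [ECinPC_unload] never reads. *)
Definition slot (K : knowledge L) (s : S) (j : nat) : mailbox (L.-tuple bool) B :=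
  fun a => send P K s (index (nth set0 (shared_edges K a) j) (port_ids K), a).

(* The second component records the inboxes of the past rounds, so that its
   size is also the round number. *)
Definition ECinPC : protocol (PC n L B) (S * seq (mailbox (L.-tuple bool) B)) :=
  Protocol (M := PC n L B)
    (fun K sh => slot K sh.1 (size sh.2))
    (fun K sh inbox => (sh.1, rcons sh.2 inbox)).

Definition ECinPC_unload (K : knowledge L)
    (sh : S * seq (mailbox (L.-tuple bool) B)) : S :=
  receive P K sh.1 (fun ia =>
    let X := nth set0 (port_ids K) ia.1 in
    if ia.2 \in X
    then nth (fun=> None) sh.2 (index X (shared_edges K ia.2)) ia.2 else None).

(** The simulated state stays fixed throughout, so every slot is computed from the state that starts
    the EC round. *)
Lemma run_ECinPC (N : network n L) (s : N -> S) k v :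
  run ECinPC k (fun u => (s u, [::])) v
    = (s v, mkseq (fun j => deliver (m := PC n L B)
                     (fun u => slot (initial_knowledge u) (s u) j) v) k).
Proof.
elim: k v => [|k IHk] v //.
rewrite /run iterS -/(run _ _ _) {1}/step IHk /ECinPC; cbn [send receive fst snd].
rewrite mkseqS; congr (_, rcons _ (deliver (m := PC n L B) _ v)).
by apply: functional_extensionality => u; rewrite IHk /= size_mkseq.
Qed.

Lemma unload_ECinPC (N : network n L) (s : N -> S) v :
  ECinPC_unload (initial_knowledge v)
    (run ECinPC (max_pair_degree N) (fun u => (s u, [::])) v) = step P s v.
Proof.
rewrite run_ECinPC /ECinPC_unload /step; cbn [fst snd].
congr (receive _ _ _ _); apply: functional_extensionality => -[i a].
cbn [fst snd]; rewrite nth_port_ids.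
have [[u ->]|no_a] := id_cases N a; last first.
  rewrite deliver_EC_None //; case: ifP => // /imsetP[u _ def_a].
  by have := no_a u; rewrite def_a eqxx.
rewrite deliver_EC mem_ids; set e := nth _ _ _.
have [ue|//] := boolP (u \in e); rewrite andTb.
(* An edge containing [u] is not the default [set0], so [i] is a valid port. *)
have ev : e \in port v.
  apply: mem_nth; rewrite ltnNge; apply/negP => ge_i.
  by move: ue; rewrite /e nth_default ?inE.
set j := index _ _.
(* Neither model delivers from a vertex to itself; here [j] may exceed the recorded rounds, where
   the default is an empty inbox. *)
have [uv|uv] := eqVneq u v.
  have [lt_k|ge_k] := ltnP j (max_pair_degree N); last first.
    by rewrite nth_default ?size_mkseq.
  by rewrite nth_mkseq // deliver_PC /adjacent uv eqxx.
have e_shared : ids e \in shared_edges (initial_knowledge v) (net_id u).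
  by rewrite mem_enum inE mem_ids ue andbT; exact: map_f.
have lt_j : j < max_pair_degree N.
  apply: leq_trans (size_shared_edges (u := v) (v := u) _); last by rewrite eq_sym.
  by rewrite index_mem.
rewrite nth_mkseq // deliver_PC.
have -> : adjacent u v by apply/adjacentP; split=> //; exists e.
(* Both ends hold the same list, so slot [j] is about [e], which the sender finds among its own
   ports. *)
by rewrite /slot shared_edgesC nth_index // index_port_ids.
Qed.

End ECinPC.

(** * From one round to whole algorithms *)

Lemma runD n L B (M : model n L B) S (P : protocol M S) (N : network n L) k l
    (s : N -> S) :
  run P (k + l) s = run P k (run P l s).
Proof. exact: iterD. Qed.

Section RoundByRound.

Variables (n L B : nat) (M1 M2 : model n L B) (S S' : Type).
Variables (P : protocol M1 S) (Q : protocol M2 S').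
Variables (load : knowledge L -> S -> S') (unload : knowledge L -> S' -> S).
Variable r : nat.

(* The state also holds the last simulated state, since nothing says that
   [unload] is a left inverse of [load], and the number of rounds since then. *)
Definition repeat_simulation : protocol M2 (S * S' * nat) :=
  Protocol (fun K x => send Q K x.1.2)
    (fun K x inbox =>
       let s' := receive Q K x.1.2 inbox in
       if x.2.+1 == r
       then let s := unload K s' in (s, load K s, 0)
       else (x.1.1, s', x.2.+1)).

Definition loaded K s : S * S' * nat := (s, load K s, 0).

Variable N : network n L.
Hypothesis simP : forall (s : N -> S) (v : N),
  unload (initial_knowledge v)
    (run Q r (fun u => load (initial_knowledge u) (s u)) v) = step P s v.

Lemma run_repeat_lt (s : N -> S) k : k < r ->
  run repeat_simulation k (fun u => loaded (initial_knowledge u) (s u))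
    = fun v => (s v, run Q k (fun u => load (initial_knowledge u) (s u)) v, k).
Proof.
elim: k => [//|k IHk] lt_k.
rewrite /run iterS -/(run _ _ _) IHk 1?ltnW //.
apply: functional_extensionality => v.
by rewrite {1}/step /=; case: eqVneq lt_k => // ->; rewrite ltnn.
Qed.

(** All [r] rounds run [Q]; the last also brings the counter to [r], so the new state is unloaded
    and loaded afresh. *)
Lemma run_repeat_round (s : N -> S) : 0 < r ->
  run repeat_simulation r (fun u => loaded (initial_knowledge u) (s u))
    = fun v => loaded (initial_knowledge v) (step P s v).
Proof.
move=> r_gt0; apply: functional_extensionality => v.
rewrite -simP -(prednK r_gt0) /run !iterS -/(run _ _ _) run_repeat_lt ?prednK //.
by rewrite {1}/step /= prednK // eqxx.
Qed.

Lemma run_repeat (s : N -> S) T : 0 < r ->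
  run repeat_simulation (r * T) (fun u => loaded (initial_knowledge u) (s u))
    = fun v => loaded (initial_knowledge v) (run P T s v).
Proof.
move=> r_gt0; elim: T => [|T IHT]; first by rewrite muln0.
by rewrite mulnS runD IHT run_repeat_round.
Qed.

(** Without communication a simulated step is a local function at each vertex, so it can be iterated
    there. *)
Lemma run_repeat0 (s : N -> S) T v : r = 0 ->
  run P T s v
    = iter T (fun x => unload (initial_knowledge v) (load (initial_knowledge v) x))
        (s v).
Proof.
move=> r0; elim: T v => [//|T IHT] v.
by rewrite iterS -IHT /run iterS -/(run _ _ _) -simP r0.
Qed.

End RoundByRound.

(* For [r = 0] the simulating algorithm has no round at all, and all the
   simulated rounds are computed locally in [result]. *)
Lemma solvable_simulated n L B (M1 M2 : model n L B)
    (rounds : network n L -> nat) (t : task n L) D r T :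
  round_simulated M1 M2 rounds ->
  (forall N : network n L, max_pair_degree N = D -> rounds N = r) ->
  solvable_in M1 t D T -> solvable_in M2 t D (r * T).
Proof.
move=> sim rounds_r [A solA].
have [S' [Q [load [unload simQ]]]] := sim _ (code A).
exists (Algorithm (fun K x => loaded load K (init A K x))
  (repeat_simulation Q load unload r)
  (fun K x => result A K
     (if r == 0 then iter T (fun s => unload K (load K s)) x.1.1 else x.1.1))).
move=> N x degN admx; have := solA N x degN admx.
(* Fixing the maximum 2-degree makes the round count constant, as the counter of the simulation
   requires. *)
have simN s v := simQ N s v; rewrite (rounds_r N degN) in simN.
congr (solution x _); apply: functional_extensionality => v.
rewrite /execute /=; congr (result A _ _).
case: (posnP r) => [r0|r_gt0].
  by rewrite {2}r0 mul0n; exact: (run_repeat0 (load := load) (unload := unload) simN).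
by rewrite (run_repeat (load := load) (unload := unload) simN
  (fun u => init A (initial_knowledge u) (x u))).
Qed.

Theorem proposition7 (B L : nat -> nat) (hB : bigTheta_log B)
    (hL : bigO_log L) (n : nat) :
  [/\ round_simulated (PC n (L n) (B n)) (EC n (L n) (B n)) (fun _ => 1),
      round_simulated (EC n (L n) (B n)) (PC n (L n) (B n))
        (fun N => max_pair_degree N)
    & forall (t : task n (L n)) (Delta2 T_PC T_EC : nat),
        has_complexity (PC n (L n) (B n)) t Delta2 T_PC ->
        has_complexity (EC n (L n) (B n)) t Delta2 T_EC ->
        T_EC <= T_PC <= Delta2 * T_EC].
Proof.
have simPC : round_simulated (PC n (L n) (B n)) (EC n (L n) (B n)) (fun _ => 1).
  move=> S P; exists S, (PCinEC P), (fun _ s => s), (fun _ s => s) => N s v.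
  exact: step_PCinEC.
have simEC : round_simulated (EC n (L n) (B n)) (PC n (L n) (B n))
    (fun N => max_pair_degree N).
  move=> S P; exists _, (ECinPC P), (fun _ s => (s, [::])), (ECinPC_unload P).
  exact: unload_ECinPC.
split=> // t D T_PC T_EC [solPC minPC] [solEC minEC]; apply/andP; split.
  by apply: minEC; rewrite -[T_PC]mul1n; exact: solvable_simulated simPC _ solPC.
exact: minPC (solvable_simulated simEC (fun _ degN => degN) solEC).
Qed.
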